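(* For all sufficiently small $\gamma > 0$, there is a triangular graph $H$ with $$\frac{\alpha_1(H) + 2\tau_1(H)}{|E(H)|} \geq 3 - \sqrt{3} - \gamma > 1.26.$$
   Context: Graphs are finite and simple. $E(H)$ denotes the edge set of $H$. A triangle independent set in a graph $H$ is a set of edges of $H$ containing at most one edge from each triangle of $H$; $\alpha_1(H)$ denotes the size of a largest triangle independent set in $H$. A triangle edge cover in $H$ is a set of edges of $H$ containing at least one edge from each triangle of $H$ (equivalently, a set of edges whose deletion makes $H$ triangle-free); $\tau_1(H)$ denotes the size of a smallest triangle edge cover in $H$. A graph is triangular if every edge lies in some triangle. Ratios with denominator $|E(H)|$ presuppose that $H$ has at least one edge. *)

(* Defs.v *)
From HB Require Import structures.
From mathcomp Require Import all_boot.

Set Implicit Arguments.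
Unset Strict Implicit.
Unset Printing Implicit Defensive.

Record sgraph := SGraph {
  vertex :> finType;
  adj : rel vertex;
  adj_sym : symmetric adj;
  adj_irrefl : irreflexive adj }.

Section Triangles.
Variable H : sgraph.

Definition edges : {set {set H}} :=
  [set [set p.1; p.2] | p : H * H & adj p.1 p.2].

(* A triangle is represented by the set of its three edges. *)
Definition triangles : {set {set {set H}}} :=
  [set [set [set p.1.1; p.1.2]; [set p.1.2; p.2]; [set p.1.1; p.2]]
     | p : H * H * H
     & [&& adj p.1.1 p.1.2, adj p.1.2 p.2 & adj p.1.1 p.2]].

Definition triangular : bool :=
  [forall e in edges, [exists t in triangles, e \in t]].

Definition triangle_independent (I : {set {set H}}) : bool :=
  (I \subset edges) && [forall t in triangles, #|I :&: t| <= 1].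

Definition triangle_cover (C : {set {set H}}) : bool :=
  (C \subset edges) && [forall t in triangles, 1 <= #|C :&: t|].

Definition alpha1 : nat := \max_(I | triangle_independent I) #|I|.

(* [arg min_] needs a default satisfying the constraint: [edges] is a triangle
   edge cover by [triangle_cover_edges] below. *)
Definition tau1 : nat := #|[arg min_(C < edges | triangle_cover C) #|C|]|.

Lemma triangle_cover_edges : triangle_cover edges.
Proof.
rewrite /triangle_cover subxx /=; apply/forall_inP => t /imsetP [[[x y] z]] /=.
rewrite inE /= => /and3P [xy _ _] ->; apply/card_gt0P; exists [set x; y].
rewrite inE !in_setU !in_set1 eqxx /= andbT.
by apply/imsetP; exists (x, y); rewrite ?inE.
Qed.

Lemma tau1_spec :
  (exists2 C, triangle_cover C & #|C| = tau1) /\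
  (forall C, triangle_cover C -> tau1 <= #|C|).
Proof.
rewrite /tau1; case: arg_minnP => [|C covC minC]; first exact: triangle_cover_edges.
by split=> [|D /minC //]; exists C.
Qed.

End Triangles.

(* Main.v *)
Require Import Defs.
From HB Require Import structures.
From mathcomp Require Import all_boot all_order all_algebra reals finfield.
From mathcomp Require Import ring lra zify.

(** The witness is the cone of a pseudorandom triangle-free graph [G] over
[b] independent apexes. Let [G] have [n] vertices and [m] edges, and suppose
that every set of [x * n] vertices spans at least about [x ^ 2 * m] edges.
- The edges of [G] are triangle independent, since a triangle of the cone has
  exactly one apex; so [alpha1 >= m] ([alpha1_cone]).
- Let [C] cover all triangles, and let [S] be the set of vertices whose edge to
  a given apex is not in [C]. All edges of [G] inside [S] are in [C], so [C]
  has at least about [x ^ 2 * m] edges of [G], where [#|S| = x * n]; it also has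
  [(1 - x) * n] edges at that apex. Averaging over the apexes and minimising
  over [x] bounds [tau1] below ([tau1_cone]).

With [b * n = c * m] the minimum is [(c - c ^ 2 / 4) * m], attained at
[x = c / 2], so the ratio is about [(1 + 2 * c - c ^ 2 / 2) / (1 + c)]. It is
maximal at [c = sqrt 3 - 1], where it equals [2 - c = 3 - sqrt 3].

For [G] take the affine plane over a finite field of order [q], joining two
points when their difference is [(x, x ^ 2)] or [- (x, x ^ 2)] with [x != 0].
In odd characteristic a triangle in it would give either a product of two
nonzero elements equal to zero or a nontrivial zero of [x ^ 2 + x * y + y ^ 2];
this form is anisotropic over the field of order [p] when [p] is an odd prime
congruent to 2 modulo 3 ([aniso_Fp]), and there are infinitely many such primes
([prime_2mod3_gt]). The edge distribution comes from a second moment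
([edges_within_parab_ge]): two distinct points lie on at most one common
translate of the parabola, so the number of points of [S] on the parabola
translated to [u] is, for most [u], close to its mean [#|S| / q]. *)

Set Implicit Arguments.
Unset Strict Implicit.
Unset Printing Implicit Defensive.

Import Order.TTheory GRing.Theory Num.Theory.
Local Open Scope ring_scope.

(** * Cones over triangle-free graphs *)

Lemma set2_eq (T : finType) (a b c d : T) :
  [set a; b] = [set c; d] -> (a = c /\ b = d) \/ (a = d /\ b = c).
Proof.
move=> E.
have: a \in [set c; d] by rewrite -E set21.
have: b \in [set c; d] by rewrite -E set22.
have: c \in [set a; b] by rewrite E set21.
have: d \in [set a; b] by rewrite E set22.
rewrite !inE => /orP [] /eqP ? /orP [] /eqP ? /orP [] /eqP ? /orP [] /eqP ?; subst; auto.
Qed.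

Definition triangle_free (G : sgraph) : Prop :=
  forall x y z : G, adj x y -> adj y z -> adj x z -> False.

Definition edges_within (G : sgraph) (S : {set G}) : {set {set G}} :=
  [set e in edges G | e \subset S].

Section Cone.
Variables (G : sgraph) (b : nat).

Definition cone_adj (x y : G + 'I_b) : bool :=
  match x, y with
  | inl u, inl v => adj u v
  | inr _, inr _ => false
  | _, _ => true
  end.

Lemma cone_adj_sym : symmetric cone_adj.
Proof. by move=> [u|i] [v|j] //=; rewrite adj_sym. Qed.

Lemma cone_adj_irrefl : irreflexive cone_adj.
Proof. by move=> [u|i] //=; rewrite adj_irrefl. Qed.

Definition cone : sgraph := SGraph cone_adj_sym cone_adj_irrefl.

(** The edges of the cone split into those of [G] and the spokes, which join a
vertex of [G] to an apex. *)
Definition base_edges : {set {set cone}} :=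
  [set [set inl u | u in e] | e : {set G} in edges G].

Definition spoke (p : G * 'I_b) : {set cone} := [set inl p.1; inr p.2].

Definition spokes : {set {set cone}} := [set spoke p | p in setT].

Lemma spoke_inj : injective spoke.
Proof. by move=> [u i] [v j] /set2_eq [] [] //= [->] [->]. Qed.

Lemma lift2 (u v : G) :
  [set (inl x : cone) | x in [set u; v]] = [set inl u; inl v].
Proof. by rewrite imsetU !imset_set1. Qed.

Lemma base_edge_inj : injective (fun e : {set G} => [set (inl u : cone) | u in e]).
Proof. by apply: imset_inj => u v []. Qed.

Lemma mem_base_edges u v :
  adj u v -> [set (inl u : cone); inl v] \in base_edges.
Proof.
move=> uv; rewrite -lift2; apply: imset_f.
by apply/imsetP; exists (u, v); rewrite ?inE.
Qed.

Lemma spokeN_base p : spoke p \notin base_edges.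
Proof.
apply/imsetP => -[e _ E].
have: (inr p.2 : cone) \in spoke p by rewrite set22.
by rewrite E => /imsetP [].
Qed.

Lemma edges_cone : edges cone = base_edges :|: spokes.
Proof.
apply/setP => e; rewrite inE; apply/imsetP/orP.
  move=> [[[u|i] [v|j]]]; rewrite inE //= => uv ->.
  - by left; exact: mem_base_edges.
  - by right; apply/imsetP; exists (u, j).
  - by right; apply/imsetP; exists (v, i); rewrite // /spoke setUC.
move=> [/imsetP [_ /imsetP [[u v] uv ->]] ->|/imsetP [[u i] _ ->]].
  by exists (inl u, inl v); rewrite ?lift2 // !inE in uv *.
by exists (inl u, inr i); rewrite ?inE.
Qed.

Lemma disjoint_base_spokes : base_edges :&: spokes = set0.
Proof.
apply/setP => e; rewrite !inE; apply/andP => -[eb /imsetP [p _ E]].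
by move: (spokeN_base p); rewrite -E eb.
Qed.

Lemma card_base_edges : #|base_edges| = #|edges G|.
Proof. exact: (card_imset _ base_edge_inj). Qed.

Lemma card_edges_cone : #|edges cone| = (#|edges G| + #|G| * b)%N.
Proof.
rewrite edges_cone cardsU disjoint_base_spokes cards0 subn0 card_base_edges.
by rewrite (card_imset _ spoke_inj) cardsT card_prod card_ord.
Qed.

Lemma mem_triangles (x y z : cone) : adj x y -> adj y z -> adj x z ->
  [set [set x; y]; [set y; z]; [set x; z]] \in triangles cone.
Proof.
move=> xy yz xz; apply/imsetP; exists (x, y, z) => //; rewrite inE.
exact/and3P.
Qed.

Lemma triangular_cone :
  (0 < b)%N -> (forall u : G, exists v, adj u v) -> triangular cone.
Proof.
move=> b_gt0 noniso; apply/forall_inP => e.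
rewrite edges_cone => /setUP [/imsetP [_ /imsetP [[u v] uv ->] ->]|].
  rewrite inE /= in uv; rewrite lift2.
  apply/exists_inP; exists [set [set (inl u : cone); inl v];
    [set (inl v : cone); inr (Ordinal b_gt0)]; [set (inl u : cone); inr (Ordinal b_gt0)]].
    exact: mem_triangles.
  by rewrite !inE eqxx.
move=> /imsetP [[u i] _ ->]; have [v uv] := noniso u.
apply/exists_inP; exists [set [set (inl u : cone); inl v];
    [set (inl v : cone); inr i]; [set (inl u : cone); inr i]].
  exact: mem_triangles.
by rewrite !inE eqxx !orbT.
Qed.

(** An apex-free triangle would be a triangle of [G], and two apexes are not
adjacent, so each triangle has one apex and a single edge in [G]. *)
Lemma alpha1_cone : triangle_free G -> (#|edges G| <= alpha1 cone)%N.
Proof.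
move=> tfG; rewrite -card_base_edges /alpha1.
apply: (@leq_bigmax_cond _ _ (fun I : {set {set cone}} => #|I|)).
rewrite /triangle_independent edges_cone subsetUl /=.
apply/forall_inP => t /imsetP [[[x y] z]] /=.
rewrite inE /= => /and3P [xy yz xz] ->.
have sN (u : G) (i : 'I_b) : ([set (inl u : cone); inr i] \in base_edges) = false.
  exact: (negbTE (spokeN_base (u, i))).
have sN' (u : G) (i : 'I_b) : ([set (inr i : cone); inl u] \in base_edges) = false.
  by rewrite setUC; exact: sN.
(* Below, [a] is the edge of the triangle opposite to its apex. *)
have only a (T : {set {set cone}}) :
    (forall c, c \in base_edges -> c \in T -> c = a) -> (#|base_edges :&: T| <= 1)%N.
  move=> H; rewrite -(cards1 a); apply: subset_leq_card; apply/subsetP => c.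
  by rewrite !inE => /andP [cb ct]; apply/eqP; exact: H.
case: x y z xy yz xz => [u|i] [v|j] [w|k] //= xy yz xz.
- by case: (tfG u v w).
- apply: (only [set (inl u : cone); inl v]) => c cb.
  by rewrite !inE => /orP [/orP [] | ] /eqP E //; move: cb; rewrite E ?sN ?sN'.
- apply: (only [set (inl u : cone); inl w]) => c cb.
  by rewrite !inE => /orP [/orP [] | ] /eqP E //; move: cb; rewrite E ?sN ?sN'.
- apply: (only [set (inl v : cone); inl w]) => c cb.
  by rewrite !inE => /orP [/orP [] | ] /eqP E //; move: cb; rewrite E ?sN ?sN'.
Qed.

(** For a cover [C] and an apex [i], let [S i] be the set of vertices whose
spoke to [i] is missing from [C]. The triangles on [i] and an edge inside [S i]
force that edge into [C], while [C] contains the [#|G| - #|S i|] other spokes at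
[i]. So [m] is at most the number of base edges in [C] plus [b] times the number
of spokes of [C] at [i]; summing over [i] gives [b * m <= b * #|C|]. *)
Lemma tau1_cone (R : realFieldType) (m : R) : (0 < b)%N ->
  (forall S : {set G},
     m <= #|edges_within S|%:R + b%:R * (#|G|%:R - #|S|%:R)) ->
  m <= (tau1 cone)%:R.
Proof.
move=> b_gt0 mP; have [[C /andP [Csub /forall_inP Ccov] <-] _] := tau1_spec cone.
pose S i := [set u : G | spoke (u, i) \notin C].
have base_le i : (#|edges_within (S i)| <= #|C :&: base_edges|)%N.
  rewrite -(card_imset _ base_edge_inj); apply: subset_leq_card.
  apply/subsetP => _ /imsetP [e eS ->]; move: eS; rewrite inE => /andP [].
  move=> /imsetP [[u v] uv ->] uvS.
  rewrite inE /= in uv uvS *; rewrite lift2 inE mem_base_edges // andbT.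
  have /Ccov/card_gt0P [c] :
      [set [set (inl u : cone); inl v]; [set (inl v : cone); inr i];
           [set (inl u : cone); inr i]] \in triangles cone.
    exact: mem_triangles.
  rewrite !inE => /andP [cC].
  have uS : u \in S i by apply: (subsetP uvS); rewrite set21.
  have vS : v \in S i by apply: (subsetP uvS); rewrite set22.
  by move: uS vS; rewrite !inE /spoke /= => uS vS
    /orP [/orP [] | ] /eqP E; rewrite -?E //; move: uS vS; rewrite -?E cC.
have spoke_card : #|C :&: spokes| = (\sum_(i < b) (#|G| - #|S i|))%N.
  have -> : C :&: spokes = [set spoke p | p in [set p | spoke p \in C]].
    apply/setP => c; rewrite inE; apply/andP/imsetP.
      by move=> [cC /imsetP [p _ E]]; exists p; rewrite // inE -E.
    by move=> [p]; rewrite inE => pC ->; split=> //; apply: imset_f.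
  rewrite (card_imset _ spoke_inj).
  rewrite -sum1_card.
  rewrite (eq_bigl (fun p : G * 'I_b => xpredT p.2 && (p.1 \notin S p.2))); last first.
    by move=> [u i]; rewrite !inE /= negbK.
  under eq_bigl => p do rewrite andTb.
  rewrite -(pair_big_dep xpredT (fun u i => u \notin S i) (fun _ _ => 1%N)) /=.
  rewrite (exchange_big_dep xpredT) //=; apply: eq_bigr => i _.
  rewrite sum1_card -(cardsC (S i)) addKn; apply: eq_card => u.
  by rewrite in_setC.
have Ccard : #|C| = (#|C :&: base_edges| + #|C :&: spokes|)%N.
  have {1}-> : C = (C :&: base_edges) :|: (C :&: spokes).
    by rewrite -setIUr -edges_cone (setIidPl Csub).
  rewrite cardsU setIACA disjoint_base_spokes setI0 cards0 subn0 //.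
have b0 : (0 : R) < b%:R by rewrite ltr0n.
rewrite -(ler_pM2l b0) Ccard natrD mulrDr spoke_card natr_sum.
have -> : b%:R * m = \sum_(i < b) m.
  by rewrite sumr_const card_ord mulr_natl.
have -> : b%:R * #|C :&: base_edges|%:R = \sum_(i < b) #|C :&: base_edges|%:R :> R.
  by rewrite sumr_const card_ord mulr_natl.
rewrite mulr_sumr -big_split /=; apply: ler_sum => i _.
apply: (le_trans (mP (S i))); rewrite natrB ?max_card //.
by rewrite lerD2r ler_nat.
Qed.

End Cone.

(** * A triangle-free graph with evenly distributed edges *)

(** Chebyshev's inequality in additive form: by the inequality of arithmetic and
geometric means, [g u - mu >= - t / 2 - (g u - mu) ^ 2 / (2 * t)]. Keeping [t]
free avoids the square root of the optimal choice. *)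
Lemma second_moment (R : realFieldType) (V : finType) (S : {set V})
    (g : V -> R) (mu t : R) : 0 < t ->
  mu * #|S|%:R - t / 2 * #|S|%:R - (\sum_u (g u - mu) ^+ 2) / (2 * t)
    <= \sum_(u in S) g u.
Proof.
move=> t_gt0.
have le_full : \sum_(u in S) (g u - mu) ^+ 2 <= \sum_u (g u - mu) ^+ 2.
  rewrite [leRHS](bigID (mem S)) /= lerDl.
  by apply: sumr_ge0 => u _; exact: sqr_ge0.
apply: (@le_trans _ _ (\sum_(u in S) (mu - t / 2 - (g u - mu) ^+ 2 / (2 * t)))).
  rewrite sumrB sumr_const -mulr_suml -mulrBl mulr_natr.
  by rewrite lerD2l lerN2 ler_pM2r // invr_gt0 mulr_gt0.
apply: ler_sum => u _; rewrite -subr_ge0.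
have -> : g u - (mu - t / 2 - (g u - mu) ^+ 2 / (2 * t))
        = (g u - mu + t) ^+ 2 / (2 * t).
  by field; rewrite gt_eqF.
by rewrite divr_ge0 ?sqr_ge0 // mulr_ge0 // ltW.
Qed.

Section Parabola.
Variable F : finFieldType.

(** With [x = v.1 - u.1], the equations say that [v - u = (x, x ^ 2)] or that
[u - v = (- x, (- x) ^ 2)]: the second is the first with [u] and [v]
exchanged. *)
Definition parab_adj (u v : F * F) : bool :=
  (u.1 != v.1) && ((v.2 - u.2 == (v.1 - u.1) ^+ 2) || (u.2 - v.2 == (v.1 - u.1) ^+ 2)).

Lemma parab_adj_sym : symmetric parab_adj.
Proof.
move=> u v; rewrite /parab_adj eq_sym orbC; congr (_ && (_ || _));
  by rewrite -(opprB v.1) sqrrN.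
Qed.

Lemma parab_adj_irrefl : irreflexive parab_adj.
Proof. by move=> u; rewrite /parab_adj eqxx. Qed.

Definition parab : sgraph := SGraph parab_adj_sym parab_adj_irrefl.

Lemma card_parab : #|parab| = (#|F| ^ 2)%N.
Proof. by rewrite /= card_prod mulnn. Qed.

Lemma parab_noniso (u : parab) : exists v, adj u v.
Proof.
exists (u.1 + 1, u.2 + 1); rewrite /= /parab_adj /= !(addrC u.1) !(addrC u.2) !addrK.
by rewrite expr1n eqxx andbT eq_sym -subr_eq0 addrK oner_eq0.
Qed.

Definition shift (u : F * F) (x : F) : F * F := (u.1 + x, u.2 + x ^+ 2).

(** The parameters of the points of [S] on the parabola with vertex [u]. *)
Definition hits (S : {set F * F}) (u : F * F) : {set F} := [set x | shift u x \in S].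

Hypothesis two_neq0 : 2 != 0 :> F.

(** Let [x], [y] and [x + y] be the steps of the first coordinate along the sides
of a triangle; the second coordinate gives [s1 x^2 + s2 y^2 = s3 (x + y)^2] for
some signs. The signs [s1 = s2 = - s3] yield twice the form
[x^2 + x y + y^2]; each of the others yields [2 u v = 0] with [u] and [v] two of
the three nonzero steps. *)
Lemma parab_triangle_free :
  (forall x y : F, x ^+ 2 + x * y + y ^+ 2 = 0 -> x = 0) -> triangle_free parab.
Proof.
move=> aniso [a a'] [b b'] [c c']; rewrite /= /parab_adj /=.
move=> /andP [ab abP] /andP [bc bcP] /andP [ac acP].
set x := b - a; set y := c - b.
have x0 : x != 0 by rewrite subr_eq0 eq_sym.
have y0 : y != 0 by rewrite subr_eq0 eq_sym.
have z0 : x + y != 0 by rewrite addrC /x /y addrA subrK subr_eq0 eq_sym.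
have nz (u v : F) : u != 0 -> v != 0 -> 2 * u * v = 0 -> False.
  move=> u0 v0 /eqP; rewrite !mulf_eq0 (negbTE u0) (negbTE v0) (negbTE two_neq0).
  by [].
have an : 2 * (x ^+ 2 + x * y + y ^+ 2) = 0 -> False.
  move=> /eqP; rewrite mulf_eq0 (negbTE two_neq0) /= => /eqP /aniso E.
  by rewrite E eqxx in x0.
have lin (p q r : F) : p = q -> r = p - q -> r = 0 by move=> -> ->; rewrite subrr.
have sgn (p q r : F) : (p == r) || (q == r) -> q = - p -> p = r \/ p = - r.
  by move=> /orP [] /eqP <- E; [left | right; rewrite E opprK].
have dx : a' - b' = - (b' - a') by rewrite opprB.
have dy : b' - c' = - (c' - b') by rewrite opprB.
have dz : a' - c' = - (c' - a') by rewrite opprB.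
have := sgn _ _ _ acP dz.
have -> : c' - a' = (b' - a') + (c' - b') by ring.
have -> : c - a = x + y by rewrite /x /y; ring.
have [-> | ->] := sgn _ _ _ abP dx; have [-> | ->] := sgn _ _ _ bcP dy; rewrite -/x -/y.
- case=> E; last by apply: an; apply: (lin _ _ _ E); ring.
  by apply: (nz x y) => //; apply: (lin _ _ _ (esym E)); ring.
- case=> E; last by apply: (nz x (x + y)) => //; apply: (lin _ _ _ E); ring.
  by apply: (nz y (x + y)) => //; apply: (lin _ _ _ (esym E)); ring.
- case=> E; last by apply: (nz y (x + y)) => //; apply: (lin _ _ _ E); ring.
  by apply: (nz x (x + y)) => //; apply: (lin _ _ _ (esym E)); ring.
- case=> E; first by apply: an; apply: (lin _ _ _ (esym E)); ring.
  by apply: (nz x y) => //; apply: (lin _ _ _ E); ring.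
Qed.

(** Each edge is counted once, from the endpoint [u] such that the other endpoint
is [shift u x]: both orientations would give [2 * x ^ 2 = 0]. The term [#|S|] is
the contribution of [x = 0], which gives no edge. *)
Lemma card_edges_within_parab (S : {set parab}) :
  (#|edges_within S| + #|S| = \sum_(u in S) #|hits S u|)%N.
Proof.
pose P := [set p : (F * F) * F | [&& p.1 \in S, p.2 \in hits S p.1 & p.2 != 0]].
pose f (p : (F * F) * F) : {set parab} := [set p.1; shift p.1 p.2].
have f_inj : {in P &, injective f}.
  move=> [u x] [v y]; rewrite !inE /= => /and3P [_ _ x0] _ /set2_eq [] [] /=.
    by move=> <- [/addrI <-].
  move=> -> E; have := congr1 snd E; have := congr1 fst E; rewrite /= -!addrA.
  rewrite -[RHS]addr0 => /addrI /(canRL (addrK _)) ->.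
  rewrite -[RHS]addr0 => /addrI /eqP; rewrite sub0r sqrrN.
  by rewrite -mulr2n -mulr_natl mulf_eq0 (negbTE two_neq0) sqrf_eq0 (negbTE x0).
have -> : edges_within S = f @: P.
  apply/setP => e; rewrite inE; apply/andP/imsetP.
    move=> [/imsetP [[u v]]]; rewrite inE /= /parab_adj => /andP [uv1 uvP] -> uvS.
    have uS : u \in S by apply: (subsetP uvS); rewrite set21.
    have vS : v \in S by apply: (subsetP uvS); rewrite set22.
    case/orP: uvP => /eqP E.
      have sE : shift u (v.1 - u.1) = v.
        by rewrite /shift -E !(addrC u.1) !(addrC u.2) !subrK -surjective_pairing.
      exists (u, v.1 - u.1); last by rewrite /f /= sE.
      by rewrite !inE /= sE uS vS subr_eq0 eq_sym.
    have sE : shift v (u.1 - v.1) = u.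
      rewrite /shift -(opprB v.1) sqrrN -E opprB !(addrC v.1) !(addrC v.2) !subrK.
      by rewrite -surjective_pairing.
    exists (v, u.1 - v.1); last by rewrite /f /= sE setUC.
    by rewrite !inE /= sE uS vS subr_eq0.
  move=> [[u x]]; rewrite !inE /= => /and3P [uS sS x0] ->; split.
    apply/imsetP; exists (u, shift u x) => //; rewrite inE /= /parab_adj /=.
    rewrite !(addrC u.1) !(addrC u.2) !addrK eqxx andbT.
    by rewrite eq_sym -subr_eq0 addrK.
  by apply/subsetP => v; rewrite !inE => /orP [] /eqP ->.
rewrite card_in_imset // -!sum1_card.
rewrite (eq_bigl (fun p : (F * F) * F => (p.1 \in S) && ((p.2 \in hits S p.1) && (p.2 != 0)))); last first.
  by move=> p; rewrite !inE.
rewrite -(pair_big_dep (mem S) (fun u x => (x \in hits S u) && (x != 0)) (fun _ _ => 1%N)) /=.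
rewrite -big_split /=; apply: eq_bigr => u uS.
have u0 : 0 \in hits S u by rewrite inE /shift expr0n /= !addr0 -surjective_pairing.
rewrite sum1_card (cardsD1 0 (hits S u)) u0 addnC; congr (_ + _)%N.
by apply: eq_card => x; rewrite !inE unfold_in inE andbC.
Qed.

Lemma sum_hits (S : {set F * F}) : (\sum_u #|hits S u| = #|F| * #|S|)%N.
Proof.
under eq_bigr => u _ do rewrite -sum1_card.
rewrite (exchange_big_dep xpredT) //=.
rewrite -sum_nat_const; apply: eq_bigr => x _.
have shift_inj : injective (fun u => shift u x).
  by move=> [a b] [c d] [/addIr -> /addIr ->].
rewrite sum1_card -(card_preimset S shift_inj).
by apply: eq_card => u; rewrite !inE -[LHS]/(x \in hits S u) inE.
Qed.

(** The square counts pairs of parameters. The diagonal gives the first moment;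
off the diagonal, two distinct points of [S] lie on at most one common
translate, because [x - y != 0] and [x ^ 2 - y ^ 2] determine [x + y] and so [x]
and [y]. *)
Lemma sum_hits_sqr (S : {set F * F}) :
  (\sum_u #|hits S u| ^ 2 <= #|F| * #|S| + #|S| ^ 2)%N.
Proof.
pose P u := [set p : F * F | [&& p.1 \in hits S u, p.2 \in hits S u & p.1 != p.2]].
have split_sqr u : (#|hits S u| ^ 2 = #|hits S u| + #|P u|)%N.
  rewrite -mulnn -cardsX -(card_imset (hits S u) (f := fun x => (x, x))); last first.
    by move=> x y [].
  rewrite -(cardsID [set p | p.1 == p.2]); congr (_ + _)%N; apply: eq_card => -[x y].
    rewrite !inE /=; apply/andP/imsetP.
      by move=> [/andP [xS _] /eqP <-]; exists x; rewrite // inE.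
    by move=> [z]; rewrite inE => zS [-> ->]; rewrite eqxx zS.
  by rewrite !inE /= andbC -andbA.
under eq_bigr => u _ do rewrite split_sqr.
rewrite big_split /= sum_hits leq_add2l -mulnn -cardsX.
pose Q := [set p : (F * F) * (F * F) | p.2 \in P p.1].
pose f (p : (F * F) * (F * F)) := (shift p.1 p.2.1, shift p.1 p.2.2).
have -> : (\sum_u #|P u| = #|Q|)%N.
  under eq_bigr => u _ do rewrite -sum1_card.
  by rewrite pair_big_dep /= -sum1_card; apply: eq_bigl => p; rewrite !inE.
rewrite -(@card_in_imset _ _ f Q).
  apply: subset_leq_card; apply/subsetP => q /imsetP [[u [x y]] pQ ->]; move: pQ.
  by rewrite !inE /= => /and3P [? ? _]; apply/andP.
move=> [[a b] [x y]] [[a' b'] [x' y']]; rewrite !inE /= => /and3P [_ _ xy] _.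
rewrite /f /shift /= => -[E1 E2 E3 E4].
have d0 : x - y != 0 by rewrite subr_eq0.
have Ed : x - y = x' - y'.
  have -> : x - y = (a + x) - (a + y) by ring.
  by rewrite E1 E3; ring.
have Es : x + y = x' + y'.
  apply: (mulfI d0); rewrite -subr_sqr Ed -subr_sqr.
  have -> : x ^+ 2 - y ^+ 2 = (b + x ^+ 2) - (b + y ^+ 2) by ring.
  by rewrite E2 E4; ring.
have Ex : x = x'.
  apply: (mulfI two_neq0); have -> : 2 * x = (x - y) + (x + y) by ring.
  by rewrite Ed Es; ring.
have Ey : y = y' by apply: (addrI x); rewrite Es Ex.
subst x' y'; by rewrite (addIr _ E1) (addIr _ E2).
Qed.

(** With [s = #|S|], the numbers [#|hits S u|] have mean [s / q] and total squared
deviation at most [(q * s + s ^ 2) - s ^ 2 = q * s]; [second_moment] then bounds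
their sum over [S]. For [1 << t << q] the error is negligible against the number
of edges, which is about [q ^ 3]. *)
Lemma edges_within_parab_ge (R : realFieldType) (S : {set parab}) (t : R) : 0 < t ->
  #|S|%:R ^+ 2 / #|F|%:R - #|S|%:R * (t / 2 + #|F|%:R / (2 * t) + 1)
   <= #|edges_within S|%:R.
Proof.
move=> t_gt0.
have q_gt0 : 0 < #|F|%:R :> R by rewrite ltr0n; apply/card_gt0P; exists 0.
set q : R := #|F|%:R in q_gt0 *; set s : R := #|S|%:R.
have /(congr1 (GRing.natmul (1 : R))) := card_edges_within_parab S.
rewrite natrD natr_sum -/s => E.
have := second_moment S (fun u => #|hits S u|%:R) (s / q) t_gt0; rewrite -E -/s => le1.
have var : \sum_u (#|hits S u|%:R - s / q) ^+ 2 <= q * s.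
  have -> : \sum_u (#|hits S u|%:R - s / q) ^+ 2
     = (\sum_u #|hits S u| ^ 2)%N%:R - 2 * (s / q) * (\sum_u #|hits S u|)%N%:R
       + #|{: F * F}|%:R * (s / q) ^+ 2.
    rewrite (eq_bigr (fun u => (#|hits S u| ^ 2)%N%:R - 2 * (s / q) * #|hits S u|%:R
                               + (s / q) ^+ 2)); last by move=> u _; rewrite natrX; ring.
    by rewrite big_split /= sumrB -mulr_sumr sumr_const -[_ *+ #|_|]mulr_natl !natr_sum.
  have : (\sum_u #|hits S u| ^ 2)%N%:R <= q * s + s ^+ 2.
    by rewrite -natrX -natrM -natrD ler_nat sum_hits_sqr.
  rewrite sum_hits card_prod !natrM -/q -/s => le2.
  have -> : 2 * (s / q) * (q * s) = 2 * s ^+ 2 by field; rewrite gt_eqF.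
  have -> : q * q * (s / q) ^+ 2 = s ^+ 2 by field; rewrite gt_eqF.
  lra.
have var' : (\sum_u (#|hits S u|%:R - s / q) ^+ 2) / (2 * t) <= q * s / (2 * t).
  by rewrite ler_pM2r // invr_gt0 mulr_gt0.
have e1 : s ^+ 2 / q = s / q * s by ring.
have e2 : s * (t / 2 + q / (2 * t) + 1) = t / 2 * s + q * s / (2 * t) + s by ring.
rewrite e1 e2; lra.
Qed.

Lemma card_edges_parab : (#|edges parab| + #|F| ^ 2 = #|F| ^ 3)%N.
Proof.
have := card_edges_within_parab setT.
have -> : edges_within [set: parab] = edges parab.
  by apply/setP => e; rewrite inE subsetT andbT.
rewrite cardsT card_parab => ->.
under eq_bigl => u do rewrite inE.
by rewrite sum_hits cardsT card_prod expnS mulnn.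
Qed.

End Parabola.

(** * Primes for which the form is anisotropic *)

(** A number congruent to 2 modulo 3 has a prime factor congruent to 2, since
factors congruent to 1 have a product congruent to 1; for [3 * N`! - 1] such a
factor exceeds [N]. *)
Lemma prime_2mod3_gt N : exists2 p, prime p & ((N < p) && (p %% 3 == 2))%N.
Proof.
have big (n : nat) : (n %% 3 = 2 -> exists2 p, prime p & (p %| n) && (p %% 3 == 2))%N.
  elim/ltn_ind: n => n IH n2.
  have n1 : (1 < n)%N by case: n n2 {IH} => [|[|]].
  have pr := pdiv_prime n1; have /dvdnP [k nE] := pdiv_dvd n.
  case: (boolP (pdiv n %% 3 == 2)%N) => [p2|p2].
    by exists (pdiv n); rewrite // pdiv_dvd.
  have p0 : (pdiv n %% 3 != 0)%N by apply/eqP => H; move: n2; rewrite nE -modnMmr H muln0.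
  have p1 : (pdiv n %% 3 = 1)%N by have := ltn_pmod (pdiv n) (isT : 0 < 3)%N; lia.
  have k2 : (k %% 3 = 2)%N by move: n2; rewrite nE -modnMmr p1 muln1.
  have kn : (k < n)%N by rewrite nE ltn_Pmulr ?prime_gt1 //; case: k k2 {nE}.
  have [p p_pr /andP [pk p3]] := IH k kn k2.
  by exists p; rewrite // p3 andbT nE dvdn_mulr.
have f_gt0 := fact_gt0 N.
have [|p p_pr /andP [pd p2]] := big (3 * N`! - 1)%N; first by lia.
exists p; rewrite // p2 andbT ltnNge; apply/negP => pN.
have : (p %| 1)%N.
  have -> : (1 = 3 * N`! - (3 * N`! - 1))%N by lia.
  by apply: dvdn_sub => //; apply: dvdn_mull; rewrite dvdn_fact // prime_gt0.
by rewrite dvdn1 => /eqP p1; rewrite p1 in p_pr.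
Qed.

(** A zero has [x ^ 3 = y ^ 3], by the factorisation of [x ^ 3 - y ^ 3]. As 3 does
not divide [p - 1], cubing is injective, so [x = y] and [3 * x ^ 2 = 0]. *)
Lemma aniso_Fp p : prime p -> (p %% 3 = 2)%N -> (2 < p)%N ->
  forall x y : 'F_p, x ^+ 2 + x * y + y ^+ 2 = 0 -> x = 0.
Proof.
move=> p_pr p3 p2 x y E.
have natF0 n : (0 < n < p)%N -> n%:R != 0 :> 'F_p.
  move=> /andP [n0 np]; rewrite -(dvdn_pcharf (pchar_Fp p_pr)).
  by apply/negP => /(dvdn_leq n0); lia.
have frob (z : 'F_p) : z = (z ^+ 3) ^+ (p %/ 3) * z ^+ 2.
  rewrite -exprM -exprD -{1}[z]expf_card card_Fp //; congr (_ ^+ _); lia.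
have cube : x ^+ 3 = y ^+ 3.
  apply/eqP; rewrite -subr_eq0.
  have -> : x ^+ 3 - y ^+ 3 = (x - y) * (x ^+ 2 + x * y + y ^+ 2) by ring.
  by rewrite E mulr0.
have [//|x0] := eqVneq x 0; have [y0|y0] := eqVneq y 0.
  by move/eqP: E; rewrite y0 mulr0 expr0n !addr0 sqrf_eq0 => /eqP.
(* [z = c * z ^ 2] for [z = x] and [z = y], with one [c], so both invert [c]. *)
have cx := frob x; have cy := frob y; rewrite -cube in cy.
set c := (x ^+ 3) ^+ _ in cx cy.
have cx1 : c * x = 1 by apply: (mulIf x0); rewrite mul1r -mulrA -expr2 -cx.
have cy1 : c * y = 1 by apply: (mulIf y0); rewrite mul1r -mulrA -expr2 -cy.
have c0 : c != 0 by apply/eqP => c0; move/eqP: cx1; rewrite c0 mul0r eq_sym oner_eq0.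
have xy : x = y by apply: (mulfI c0); rewrite cx1.
have : 3 * x ^+ 2 = 0 by rewrite -E -xy; ring.
move/eqP; rewrite mulf_eq0 sqrf_eq0 (negbTE (natF0 3%N _)) /=; first by move/eqP.
by have := p3; case: (ltngtP 3 p) p2 => // <-.
Qed.

(** * Optimising the number of apexes *)

(** Minimises [s ^ 2 / q + b * (q ^ 2 - s)] over [s] by completing the square at
[s = b * q / 2]; the error term is largest at [s = q ^ 2]. *)
Lemma tau1_cone_parab (R : realFieldType) (F : finFieldType) (b : nat) (t : R) :
  2 != 0 :> F -> (0 < b)%N -> 0 < t ->
  b%:R * #|F|%:R ^+ 2 - b%:R ^+ 2 * #|F|%:R / 4
    - #|F|%:R ^+ 2 * (t / 2 + #|F|%:R / (2 * t) + 1) <= (tau1 (cone (parab F) b))%:R.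
Proof.
move=> F2 b_gt0 t_gt0; apply: (tau1_cone b_gt0) => S.
have q_gt0 : 0 < #|F|%:R :> R by rewrite ltr0n; apply/card_gt0P; exists 0.
have := edges_within_parab_ge F2 S t_gt0; rewrite card_parab natrX.
have : #|S|%:R <= #|F|%:R ^+ 2 :> R by rewrite -natrX ler_nat -card_parab max_card.
set q : R := #|F|%:R in q_gt0 *; set s : R := #|S|%:R; set e : R := _%:R; set k : R := b%:R.
have err_ge0 : 0 <= t / 2 + q / (2 * t) + 1.
  by rewrite !addr_ge0 ?divr_ge0 ?mulr_ge0 ?ltW.
set err := t / 2 + _ + 1 in err_ge0 * => s_le e_ge.
have s_err := ler_wpM2r err_ge0 s_le.
have : 0 <= (s - k * q / 2) ^+ 2 / q by rewrite divr_ge0 ?sqr_ge0 ?ltW.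
have -> : (s - k * q / 2) ^+ 2 / q = s ^+ 2 / q - k * s + k ^+ 2 * q / 4.
  by field; rewrite gt_eqF.
lra.
Qed.

Lemma sqrt3_lt (R : rcfType) : Num.sqrt 3 < 1733 / 1000 :> R.
Proof.
have -> : 1733 / 1000 = Num.sqrt ((1733 / 1000) ^+ 2) :> R.
  by rewrite sqrtr_sqr ger0_norm //; lra.
by rewrite ltr_sqrt; lra.
Qed.

Lemma sqrt3_gt (R : rcfType) : 3 / 2 <  Num.sqrt 3 :> R.
Proof.
have -> : 3 / 2 = Num.sqrt ((3 / 2) ^+ 2) :> R.
  by rewrite sqrtr_sqr ger0_norm //; lra.
by rewrite ltr_sqrt; lra.
Qed.

(** With [b = c * q - d], the main terms of [alpha + 2 * tau] exceed [2 - c] times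
the number of edges by [q ^ 2 * (1 - c) - d ^ 2 * q / 2] exactly, because
[c ^ 2 = 2 - 2 * c] cancels the terms of order [q ^ 3]: rounding [b] to an
integer has only a second-order effect. The errors sum to at most [5 * w] for
[w = q ^ 3 / K], and [gamma] times the number of edges absorbs them. *)
Lemma ratio_arith (R : rcfType) (q K b gamma alpha tau : R) :
  let c := Num.sqrt 3 - 1 in
  1 <= K -> 10 <= gamma * K -> K ^+ 2 <= q -> 2 <= q -> b <= c * q <= b + 1 ->
  0 <= b ->
  q ^+ 3 - q ^+ 2 <= alpha ->
  b * q ^+ 2 - b ^+ 2 * q / 4 - q ^+ 2 * (K / 2 + q / (2 * K) + 1) <= tau ->
  (3 - Num.sqrt 3 - gamma) * (q ^+ 3 - q ^+ 2 + q ^+ 2 * b) <= alpha + 2 * tau.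
Proof.
move=> c K1 gK Kq q2 /andP [b1 b2] b0 alphaP tauP.
have K0 : 0 < K by lra.
have c_eq : c ^+ 2 = 2 - 2 * c.
  by rewrite /c sqrrB sqr_sqrtr //; ring.
have c_le1 : c <= 1.
  by have := sqrt3_lt R; rewrite /c; lra.
have -> : 3 - Num.sqrt 3 = 2 - c by rewrite /c; ring.
pose d := c * q - b.
have d01 : d ^+ 2 <= 1 by rewrite expr_le1 //; rewrite /d; lra.
have gamma0 : 0 < gamma by rewrite -(pmulr_lgt0 _ K0); lra.
pose w := q ^+ 3 / K.
have q3 : 0 < q ^+ 3 by apply: exprn_gt0; lra.
have Kw : K * w = q ^+ 3 by rewrite /w; field; rewrite gt_eqF.
have w0 : 0 < w by rewrite divr_gt0.
have KK : K <= K ^+ 2 by nra.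
have w1 : q ^+ 2 * K <= w.
  by rewrite ler_pdivlMr // -mulrA -expr2 [q ^+ 3]exprSr ler_pM2l ?exprn_gt0 //; lra.
have w2 : q ^+ 2 <= w.
  by rewrite ler_pdivlMr // [q ^+ 3]exprSr ler_pM2l ?exprn_gt0 //; lra.
have w3 : q <= w by apply: le_trans w2; nra.
have g1 : 5 * w <= gamma * (q ^+ 3 - q ^+ 2).
  have : q ^+ 2 * 2 <= q ^+ 3 by rewrite [q ^+ 3]exprSr ler_pM2l ?exprn_gt0 //; lra.
  have : 10 * w <= gamma * q ^+ 3 by rewrite -Kw mulrA ler_pM2r.
  nra.
have g2 : 0 <= gamma * (q ^+ 2 * b).
  by rewrite !mulr_ge0 ?exprn_ge0 //; lra.
have e1 : q ^+ 2 * (K / 2 + q / (2 * K) + 1) = (q ^+ 2 * K) / 2 + w / 2 + q ^+ 2.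
  by rewrite /w; field; rewrite gt_eqF.
rewrite e1 in tauP.
have e2 : q ^+ 3 - q ^+ 2 + 2 * (b * q ^+ 2 - b ^+ 2 * q / 4)
    - (2 - c) * (q ^+ 3 - q ^+ 2 + q ^+ 2 * b) = q ^+ 2 * (1 - c) - d ^+ 2 * q / 2.
  transitivity (q ^+ 2 * (1 - c) - d ^+ 2 * q / 2 + (c ^+ 2 - (2 - 2 * c)) * q ^+ 3 / 2).
    by rewrite /d; field.
  by rewrite c_eq subrr !mul0r addr0.
have e3 : d ^+ 2 * q <= q by nra.
have e4 : 0 <= q ^+ 2 * (1 - c) by rewrite mulr_ge0 ?sqr_ge0 //; lra.
lra.
Qed.

Theorem corollary3p7 (R : realType) :
  exists2 gamma0 : R, 0 < gamma0 &
    forall gamma : R, 0 < gamma -> gamma < gamma0 ->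
      exists H : sgraph,
        [/\ triangular H,
            (0 < #|edges H|)%N,
            ((alpha1 H)%:R + 2 * (tau1 H)%:R) / #|edges H|%:R
              >= 3 - Num.sqrt 3 - gamma :> R
          & 3 - Num.sqrt 3 - gamma > 126 / 100 :> R].
Proof.
have s3lt := sqrt3_lt R; have s3gt := sqrt3_gt R.
exists (1 / 1000); first by lra.
move=> gamma g0 g1.
have [K K1 gK] : exists2 K : nat, (0 < K)%N & 10 <= gamma * K%:R.
  exists (Num.bound (10 / gamma)).
    by rewrite -(ltr0n R); apply: le_lt_trans (archi_boundP _); rewrite divr_ge0 ?ltW.
  rewrite mulrC -ler_pdivrMr //; apply: ltW; apply: archi_boundP.
  by rewrite divr_ge0 ?ltW.
have [p p_pr /andP [pK /eqP p3]] := prime_2mod3_gt (K ^ 2 + 2)%N.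
have p2 : (2 < p)%N by lia.
have F2 : 2 != 0 :> 'F_p.
  rewrite -(dvdn_pcharf (pchar_Fp p_pr)); apply/negP => /(dvdn_leq (isT : 0 < 2)%N).
  by lia.
have F_card : #|'F_p| = p by rewrite card_Fp.
have F_aniso := aniso_Fp p_pr p3 p2.
pose c : R := Num.sqrt 3 - 1.
have cp0 : 0 <= c * p%:R by rewrite mulr_ge0 // /c; lra.
pose b := Num.truncn (c * p%:R).
have /andP [b1 b2] : b%:R <= c * p%:R < b.+1%:R by exact: truncn_itv.
have q2 : 2 <= p%:R :> R by rewrite (ler_nat _ 2) ltnW.
have b_gt0 : (0 < b)%N.
  rewrite -ltnS -(ltr_nat R); apply: le_lt_trans b2.
  by rewrite /c; nra.
pose H := cone (parab 'F_p) b.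
have Hcard : #|edges H|%:R = p%:R ^+ 3 - p%:R ^+ 2 + p%:R ^+ 2 * b%:R :> R.
  have /(congr1 (GRing.natmul (1 : R))) := card_edges_parab F2.
  rewrite F_card natrD !natrX => E.
  by rewrite card_edges_cone card_parab F_card natrD natrM natrX -E; ring.
have E0 : (0 < #|edges H|)%N.
  rewrite card_edges_cone card_parab F_card addn_gt0 muln_gt0 b_gt0 expn_gt0.
  by rewrite (ltn_trans _ p2) // orbT.
exists H; split=> //; last by lra.
  by apply: triangular_cone => // u; exact: parab_noniso.
rewrite ler_pdivlMr ?ltr0n // Hcard.
apply: (@ratio_arith R p%:R K%:R b%:R) => //.
- by rewrite (ler_nat _ 1).
- by rewrite -natrX ler_nat (leq_trans _ (ltnW pK)) ?leq_addr.
- by rewrite b1 /= -natr1 in b2 *; exact: ltW.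
- have := alpha1_cone b (parab_triangle_free F2 F_aniso).
  rewrite -(ler_nat R); apply: le_trans.
  have /(congr1 (GRing.natmul (1 : R))) := card_edges_parab F2.
  by rewrite F_card natrD !natrX => <-; rewrite addrK.
- have K0 : 0 < K%:R :> R by rewrite ltr0n.
  by have := tau1_cone_parab F2 b_gt0 K0; rewrite F_card.
Qed.
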